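(* Let $n\ge 1$. For the class $\mathcal{G}$ of metric sequential transportation games with $n$ players (and any number $m\ge 2$ of buses), $\mathrm{SPoA}(U,\mathcal{G})=2n-1$.
   Context: Transportation game. An instance $\Gamma$ consists of a set of players $N=\{1,\dots,n\}$ ($n\ge 1$), a set of buses $M=\{1,\dots,m\}$ with $m\ge 2$, a complete undirected graph on the vertex set $V=N\cup\{s,t\}$ ($s$ the source, $t$ the destination) with a distance function $d$ assigning a nonnegative real $d(x,y)=d(y,x)$ to each edge (with $d(x,x)=0$), and for each bus $j\in M$ a permutation $\pi_j$ of $N$. The instance is metric if $d(x,w)\le d(x,y)+d(y,w)$ for all $x,y,w\in V$. Distances between distinct vertices may be $0$. An outcome is a map $\sigma:N\to M$, $\sigma_i$ being the bus chosen by player $i$; $\mathcal{P}$ is the set of outcomes. Given $\sigma$, bus $j$ starts at $s$, visits exactly the players $i$ with $\sigma_i=j$, in the order in which they appear in $\pi_j$, and ends at $t$. Let $n_j=|\{i:\sigma_i=j\}|$, let $p^j_i$ be the $i$-th player visited by bus $j$, and put $p^j_{n_j+1}=t$. The cost of the player $p^j_k$ is $c_{p^j_k}(\sigma)=\sum_{l=k}^{n_j} d(p^j_l,p^j_{l+1})$, the distance travelled by her bus from her location to $t$. The utilitarian social cost function is $U(\sigma)=\sum_{i\in N}c_i(\sigma)$. Sequential version. Players choose buses in the order $1,2,\dots,n$, each observing all earlier choices. A strategy of player $i$ is a function $\lambda_i$ assigning a bus to each possible history $\sigma_{<i}=(\sigma_1,\dots,\sigma_{i-1})\in M^{i-1}$;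 a strategy profile is $\lambda=(\lambda_1,\dots,\lambda_n)$. Its outcome is the $\sigma$ with $\sigma_i=\lambda_i(\sigma_{<i})$ for all $i$. A strategy profile $\lambda$ is a subgame perfect equilibrium (SPE) if for every player $i$ and every history $\sigma_{<i}$, player $i$ cannot decrease her cost by choosing a bus other than $\lambda_i(\sigma_{<i})$ after the history $\sigma_{<i}$, when players $i+1,\dots,n$ then play according to $\lambda_{i+1},\dots,\lambda_n$. An SPE always exists. For a social cost function $f$, $f(\lambda)$ denotes $f$ of the outcome of $\lambda$. With $\sigma^*\in\mathcal{P}$ minimizing $f$, $\mathrm{SPoA}(f,\Gamma)=\max_{\lambda\in \mathrm{SPE}(\Gamma)} f(\lambda)/f(\sigma^* )$, and for a class $\mathcal{G}$ of games $\mathrm{SPoA}(f,\mathcal{G})=\sup_{\Gamma\in\mathcal{G}}\mathrm{SPoA}(f,\Gamma)$, the supremum being over the $\Gamma\in\mathcal{G}$ with $f(\sigma^* )>0$. *)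

(* Defs.v *)
From HB Require Import structures.
From mathcomp Require Import all_boot all_order all_algebra all_fingroup.
From mathcomp Require Import classical_sets reals constructive_ereal ereal.

Set Implicit Arguments.
Unset Strict Implicit.
Unset Printing Implicit Defensive.

Import Order.TTheory GRing.Theory Num.Theory.
Local Open Scope ring_scope.

Inductive vertex (n : nat) : Type :=
  | Source
  | Destination
  | Player of 'I_n.
Arguments Source {n}.
Arguments Destination {n}.

(* Players choose their buses in the increasing order of 'I_n;
   [bus_perm j k] is the player at position k of the permutation of bus j. *)
Record game (R : realType) (n : nat) : Type := Game {
  buses : nat;
  buses_ge2 : (2 <= buses)%N;
  dist : vertex n -> vertex n -> R;
  dist_ge0 : forall x y, 0 <= dist x y;
  dist_sym : forall x y, dist x y = dist y x;
  dist_refl : forall x, dist x x = 0;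
  bus_perm : 'I_buses -> {perm 'I_n}
}.

Definition metric (R : realType) (n : nat) (G : game R n) : Prop :=
  forall x y w, dist G x w <= dist G x y + dist G y w.

Section Game.
Variables (R : realType) (n : nat) (G : game R n).

Notation bus := 'I_(buses G).

Definition bus0 : bus := Ordinal (ltnW (buses_ge2 G)).

Definition outcome := {ffun 'I_n -> bus}.

Definition route (sigma : outcome) (j : bus) : seq 'I_n :=
  [seq i <- [seq bus_perm j k | k <- enum 'I_n] | sigma i == j].

Definition load (sigma : outcome) (j : bus) : nat :=
  #|[set i | sigma i == j]|.

(* Positions start at 0, so that position [load sigma j] is the destination. *)
Definition stop (sigma : outcome) (j : bus) (l : nat) : vertex n :=
  nth Destination [seq Player i | i <- route sigma j] l.

Definition cost (i : 'I_n) (sigma : outcome) : R :=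
  let j := sigma i in
  \sum_(index i (route sigma j) <= l < load sigma j)
    dist G (stop sigma j l) (stop sigma j l.+1).

Definition utilitarian (sigma : outcome) : R := \sum_(i < n) cost i sigma.

Definition history (i : nat) := {ffun 'I_i -> bus}.

Definition past (sigma : outcome) (i : 'I_n) : history i :=
  [ffun k : 'I_i => sigma (widen_ord (ltnW (ltn_ord i)) k)].

Definition strategy (i : nat) := {ffun history i -> bus}.

Definition profile := {dffun forall i : 'I_n, strategy i}.

Definition is_outcome (lambda : profile) (sigma : outcome) : bool :=
  [forall i : 'I_n, sigma i == lambda i (past sigma i)].

Definition is_continuation (lambda : profile) (i : 'I_n) (h : history i)
    (b : bus) (sigma : outcome) : bool :=
  [&& past sigma i == h, sigma i == b &
      [forall k : 'I_n, (i < k)%N ==> (sigma k == lambda k (past sigma k))]].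

Lemma play_exists (g : forall i : 'I_n, history i -> bus) :
  exists sigma : outcome, forall i, sigma i = g i (past sigma i).
Proof.
pose F (s : outcome) : outcome := [ffun i => g i (past s i)].
pose s0 : outcome := [ffun=> bus0].
have stable p q (i : 'I_n) : (i < p)%N -> (p <= q)%N ->
    iter p F s0 i = iter q F s0 i.
  elim: p q i => [//|p IHp] [//|q] i; rewrite !ltnS => ip pq /=.
  rewrite !ffunE; congr (g i _); apply/ffunP => k; rewrite !ffunE.
  by apply: IHp => //=; apply: leq_trans (ltn_ord k) ip.
exists (iter n F s0) => i.
by rewrite (stable n n.+1) //= ffunE.
Qed.

Lemma play_unique (g : forall i : 'I_n, history i -> bus)
    (sigma tau : outcome) :
  (forall i, sigma i = g i (past sigma i)) ->
  (forall i, tau i = g i (past tau i)) -> sigma = tau.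
Proof.
move=> gs gt; apply/ffunP => i.
have [p] := ubnP (i : nat); elim: p i => // p IHp i; rewrite ltnS => ip.
rewrite gs gt; congr (g i _); apply/ffunP => k; rewrite !ffunE.
by apply: IHp => /=; apply: leq_trans (ltn_ord k) ip.
Qed.

Lemma outcome_exists (lambda : profile) : exists sigma, is_outcome lambda sigma.
Proof.
have [s sP] := play_exists (fun i h => lambda i h).
by exists s; apply/forallP => i; apply/eqP.
Qed.

Lemma is_outcome_unique (lambda : profile) (sigma tau : outcome) :
  is_outcome lambda sigma -> is_outcome lambda tau -> sigma = tau.
Proof.
move=> /forallP s /forallP t.
by apply: (@play_unique (fun i h => lambda i h)) => i; apply/eqP.
Qed.

Lemma continuation_exists (lambda : profile) (i : 'I_n) (h : history i)
    (b : bus) : exists sigma, is_continuation lambda h b sigma.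
Proof.
have [s sP] := play_exists (fun k h' =>
  if insub (k : nat) is Some k' then h k'
  else if k == i then b else lambda k h').
exists s; apply/and3P; split.
- by apply/eqP/ffunP => k; rewrite ffunE sP valK.
- by rewrite sP insubN ?ltnn // eqxx.
- apply/forallP => k; apply/implyP => ik; rewrite {1}sP insubN ?ifN //.
    by rewrite neq_ltn ik orbT.
  by rewrite -leqNgt ltnW.
Qed.

Lemma is_continuation_unique (lambda : profile) (i : 'I_n) (h : history i)
    (b : bus) (sigma tau : outcome) :
  is_continuation lambda h b sigma -> is_continuation lambda h b tau ->
  sigma = tau.
Proof.
move=> /and3P[/eqP sh /eqP si /forallP sk] /and3P[/eqP th /eqP ti /forallP tk].
apply: (@play_unique (fun k h' => if insub (k : nat) is Some k' then h k'
  else if k == i then b else lambda k h')) => k.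
- case: insubP => [k' _ kk'|]; first by
    rewrite -sh ffunE; congr (sigma _); apply: val_inj.
  rewrite -leqNgt leq_eqVlt => /orP[/eqP/val_inj <-|ik]; first by rewrite eqxx.
  by rewrite ifN ?neq_ltn ?ik ?orbT //; apply/eqP; apply: implyP (sk k) ik.
- case: insubP => [k' _ kk'|]; first by
    rewrite -th ffunE; congr (tau _); apply: val_inj.
  rewrite -leqNgt leq_eqVlt => /orP[/eqP/val_inj <-|ik]; first by rewrite eqxx.
  by rewrite ifN ?neq_ltn ?ik ?orbT //; apply/eqP; apply: implyP (tk k) ik.
Qed.

Definition outcome_of (lambda : profile) : outcome :=
  xchoose (outcome_exists lambda).

Definition continuation (lambda : profile) (i : 'I_n) (h : history i)
    (b : bus) : outcome :=
  xchoose (continuation_exists lambda h b).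

Definition is_spe (lambda : profile) : bool :=
  [forall i : 'I_n, forall h : history i, forall b : bus,
    cost i (continuation lambda h (lambda i h))
      <= cost i (continuation lambda h b)].

Definition optimum (f : outcome -> R) : outcome :=
  [arg min_(sigma < [ffun=> bus0]) f sigma]%O.

(* Extended reals are used so that the maximum has the neutral element -oo. *)
Definition spoa (f : outcome -> R) : \bar R :=
  \big[maxe/-oo%E]_(lambda : profile | is_spe lambda)
    (f (outcome_of lambda) / f (optimum f))%:E.

End Game.

Definition class_spoa (R : realType) (n : nat)
    (f : forall G : game R n, outcome G -> R) (C : set (game R n)) : \bar R :=
  ereal_sup [set spoa (f G) | G in [set G | C G /\ 0 < f G (optimum (f G))]]%classic.

(* Main.v *)
(* Let D_i be the distance from player i to the destination t. By the triangle
   inequality through t, D_i <= c_i <= D_i + 2 * sum D_k over the other players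
   k on the bus of i; so the social cost of any outcome lies between S and
   (2n - 1) S, where S = sum D_i, and equilibrium is not needed for the upper
   bound. It is attained with two buses when everybody stands at t except the
   last player, who is at distance 1 and comes last on both buses. She pays 1
   whatever she does, so she may ride bus 0 when the others all do, and bus 1 to
   punish anybody who leaves bus 0. Then all ride bus 0 and everybody else pays
   2, whereas sending her alone on a bus costs 1 in total. *)

Require Import Defs.
From mathcomp Require Import all_boot all_order all_algebra.
From mathcomp Require Import classical_sets reals constructive_ereal ereal.
From mathcomp Require Import all_fingroup lra.

Import Order.TTheory GRing.Theory Num.Theory.

Local Open Scope ring_scope.

(** * Routes and stops *)

Lemma uniq_route {R : realType} {n : nat} (G : game R n) (s : outcome G) j :
  uniq (route s j).
Proof. by rewrite filter_uniq // map_inj_uniq ?enum_uniq //; exact: perm_inj. Qed.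

Lemma mem_route {R : realType} {n : nat} (G : game R n) (s : outcome G) j i :
  (i \in route s j) = (s i == j).
Proof.
rewrite mem_filter; case: eqP => //= _.
by rewrite -(permKV (bus_perm j) i) map_f ?mem_enum.
Qed.

Lemma size_route {R : realType} {n : nat} (G : game R n) (s : outcome G) j :
  size (route s j) = load s j.
Proof.
rewrite -(card_uniqP (uniq_route G s j)).
by apply: eq_card => i; rewrite inE mem_route.
Qed.

Lemma stop_index {R : realType} {n : nat} (G : game R n) (s : outcome G) i :
  stop s (s i) (index i (route s (s i))) = Player i.
Proof.
have ir : i \in route s (s i) by rewrite mem_route.
by rewrite /stop (nth_map i) ?index_mem // nth_index.
Qed.

Lemma stop_load {R : realType} {n : nat} (G : game R n) (s : outcome G) j :
  stop s j (load s j) = Destination.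
Proof. by rewrite /stop nth_default // size_map size_route. Qed.

(** * Bounds in a metric game *)

Lemma dist_le_path {R : realType} {n : nat} (G : game R n) (hG : metric G)
    (f : nat -> vertex n) a b : (a <= b)%N ->
  dist G (f a) (f b) <= \sum_(a <= l < b) dist G (f l) (f l.+1).
Proof.
move=> /subnKC <-; elim: (b - a)%N => [|k IHk].
  by rewrite addn0 big_geq // dist_refl.
rewrite addnS big_nat_recr ?leq_addr //=.
by apply: le_trans (hG _ (f (a + k)%N) _) _; rewrite lerD2r.
Qed.

(** Detour every leg through [c]. An intermediate stop then counts twice, as the end of one leg and
    the start of the next; the first stop counts once, and the last is [c] itself, at distance 0. *)
Lemma path_le_star {R : realType} {n : nat} (G : game R n) (hG : metric G)
    (f : nat -> vertex n) c a b : (a < b)%N -> f b = c ->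
  \sum_(a <= l < b) dist G (f l) (f l.+1)
    <= dist G (f a) c + 2 * \sum_(a.+1 <= l < b) dist G (f l) c.
Proof.
move=> ab fb.
apply: (@le_trans _ _ (\sum_(a <= l < b) (dist G (f l) c + dist G (f l.+1) c))).
  by apply: ler_sum => l _; rewrite (dist_sym _ (f l.+1)); exact: hG.
rewrite big_split /= big_ltn // -(big_add1 _ _ a b.+1 xpredT (fun l => dist G (f l) c)).
by rewrite big_nat_recr //= fb dist_refl addr0; lra.
Qed.

Lemma dist_le_cost {R : realType} {n : nat} (G : game R n) (hG : metric G)
    (s : outcome G) i : dist G (Player i) Destination <= cost i s.
Proof.
rewrite -{1}(stop_index G s i) -(stop_load G s (s i)).
by apply: dist_le_path => //; rewrite -size_route index_size.
Qed.

Lemma cost_le {R : realType} {n : nat} (G : game R n) (hG : metric G)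
    (s : outcome G) i :
  cost i s <= dist G (Player i) Destination +
    2 * \sum_(k | (k != i) && (s k == s i)) dist G (Player k) Destination.
Proof.
set r := route s (s i); set a := index i r.
have ar : (a < size r)%N by rewrite index_mem mem_route.
rewrite /cost -/r -/a; apply: le_trans (path_le_star G hG _ _ _ _ _ (stop_load G s (s i))) _.
  by rewrite -size_route.
rewrite stop_index lerD2l ler_pM2l // -size_route -/r.
have -> : \sum_(a.+1 <= l < size r) dist G (stop s (s i) l) Destination =
    \sum_(k <- drop a.+1 r) dist G (Player k) Destination.
  rewrite (big_nth i) size_drop -{1}(add0n a.+1) big_addn.
  apply: eq_big_nat => l /andP[_ ll].
  by rewrite nth_drop /stop (nth_map i) addnC // -ltn_subRL.
rewrite big_uniq ?drop_uniq ?uniq_route //=.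
rewrite [leRHS]big_mkcond [leLHS]big_mkcond /=.
apply: ler_sum => k _; case: ifP => [kd|_]; last by case: ifP => _ //; exact: dist_ge0.
have kr : k \in r := mem_drop kd.
rewrite -(mem_route G s) kr andbT; case: eqP => //= ki.
(* If [k = i], then [i] would occur both in the first [a.+1] entries of [r] and in the rest. *)
have := uniq_route G s (s i); rewrite -/r -(cat_take_drop a.+1 r) cat_uniq.
case/and3P => _ /hasPn /(_ _ kd) /negP[]; rewrite ki.
by move: kr; rewrite ki => ir; rewrite in_take.
Qed.

Lemma sum_dist_le_utilitarian {R : realType} {n : nat} (G : game R n)
    (hG : metric G) (s : outcome G) :
  \sum_i dist G (Player i) Destination <= utilitarian s.
Proof. by apply: ler_sum => i _; exact: dist_le_cost. Qed.

(** Letting [k] range over all other players bounds the cost of [i] by [2 * S] minus her own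
    distance; summing over [i] gives [2 * n * S - S]. *)
Lemma utilitarian_le {R : realType} {n : nat} (G : game R n) (hG : metric G)
    (s : outcome G) :
  utilitarian s
    <= (2 * n%:R - 1) * \sum_i dist G (Player i) Destination.
Proof.
set S := \sum_i _.
have ub i : cost i s <= 2 * S - dist G (Player i) Destination.
  apply: le_trans (cost_le G hG s i) _.
  have -> : S = dist G (Player i) Destination +
      \sum_(k | k != i) dist G (Player k) Destination by rewrite /S (bigD1 i).
  have : \sum_(k | (k != i) && (s k == s i)) dist G (Player k) Destination <=
      \sum_(k | k != i) dist G (Player k) Destination.
    rewrite [leRHS](bigID (fun k => s k == s i)) /= lerDl.
    by apply: sumr_ge0 => k _; exact: dist_ge0.
  by lra.
apply: le_trans (ler_sum _ (fun i _ => ub i)) _.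
rewrite sumrB -/S sumr_const card_ord -mulr_natr; lra.
Qed.

(** * The extremal game *)

Definition far_position {R : realType} {n : nat} (x : vertex n.+1) : R :=
  if x is Player i then (i == ord_max)%:R else 0.

(** Vertices are points of the real line, so the triangle inequality is that of the absolute value.
    The identity order makes the last player to choose also the last one visited on either bus. *)
Definition far_game (R : realType) (n : nat) : game R n.+1 :=
  @Game R n.+1 2 isT (fun x y => `|far_position x - far_position y|)
    (fun x y => normr_ge0 _) (fun x y => distrC _ _)
    (fun x => etrans (congr1 _ (subrr _)) (normr0 _)) (fun=> 1%g).

Lemma far_game_metric (R : realType) (n : nat) : metric (far_game R n).
Proof. by move=> x y w; exact: ler_distD. Qed.

Lemma far_dist_destination (R : realType) (n : nat) (i : 'I_n.+1) :
  dist (far_game R n) (Player i) Destination = (i == ord_max)%:R.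
Proof. by rewrite /= subr0 ger0_norm // ler0n. Qed.

Lemma far_sum_dist (R : realType) (n : nat) :
  \sum_i dist (far_game R n) (Player i) Destination = 1.
Proof.
rewrite (eq_bigr (fun i => (i == ord_max)%:R)) => [|i _]; last first.
  exact: far_dist_destination.
by rewrite (bigD1 ord_max) //= eqxx big1 ?addr0 // => i /negPf ->.
Qed.

Lemma far_index (R : realType) (n : nat) (s : outcome (far_game R n)) i :
  i != ord_max -> s i = s ord_max ->
  (index i (route s (s i)) < index ord_max (route s (s i)))%N.
Proof.
move=> im sim; set r := route _ _.
have ir : i \in r by rewrite mem_route.
have mr : ord_max \in r by rewrite mem_route sim.
have sr : sorted (relpre val ltn) r.
  rewrite /r /route (eq_map (g := id)) => [|k]; last by rewrite /= perm1.
  rewrite map_id sorted_filter // => [x y z|]; first exact: ltn_trans.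
  by rewrite -sorted_map val_enum_ord iota_ltn_sorted.
rewrite ltnNge leq_eqVlt; apply/negP => /orP[/eqP e|].
  by case/eqP: im; rewrite -[i](nth_index i ir) -e nth_index.
have relpre_trans : transitive (relpre (val : 'I_n.+1 -> nat) ltn).
  by move=> x y z; exact: ltn_trans.
by move=> /(sorted_ltn_index relpre_trans sr _ _ mr ir) /=; rewrite ltnNge -ltnS ltn_ord.
Qed.

(** The ride of [i] goes from position 0 to [ord_max] at position 1 and back to 0; each half has
    length at least 1. *)
Lemma far_cost_ge2 (R : realType) (n : nat) (s : outcome (far_game R n)) i :
  i != ord_max -> s i = s ord_max -> 2 <= cost i s.
Proof.
move=> im sim; have lt_im := far_index R n s i im sim.
have lem : (index ord_max (route s (s i)) <= load s (s i))%N.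
  by rewrite -size_route index_size.
rewrite /cost (big_cat_nat (ltnW lt_im)) //=.
have := dist_le_path _ (far_game_metric R n) (stop s (s i)) _ _ (ltnW lt_im).
have := dist_le_path _ (far_game_metric R n) (stop s (s i)) _ _ lem.
rewrite stop_load stop_index sim stop_index far_dist_destination eqxx /=.
rewrite (negPf im) eqxx sub0r normrN1; lra.
Qed.

Lemma far_cost_le (R : realType) (n : nat) (s : outcome (far_game R n)) i :
  cost i s <= (i == ord_max)%:R
    + 2 * ((i != ord_max) && (s ord_max == s i))%:R.
Proof.
apply: le_trans (cost_le _ (far_game_metric R n) s i) _.
rewrite far_dist_destination lerD2l ler_pM2l //.
rewrite (eq_bigr (fun k => (k == ord_max)%:R)) => [|k _]; last exact: far_dist_destination.
rewrite big_mkcond (bigD1 ord_max) //= eqxx big1 => [|k /negPf ->]; last by case: ifP.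
by rewrite addr0 eq_sym; case: ifP.
Qed.

Lemma far_optimum (R : realType) (n : nat) :
  utilitarian (optimum (@utilitarian R n.+1 (far_game R n))) = 1.
Proof.
apply/eqP; rewrite eq_le; apply/andP; split; last first.
  by rewrite -(far_sum_dist R n); exact/sum_dist_le_utilitarian/far_game_metric.
(* With [ord_max] alone on her bus, the extra term of [far_cost_le] vanishes for everybody. *)
pose s : outcome (far_game R n) :=
  [ffun i => if i == ord_max then (ord_max : 'I_2) else ord0].
rewrite /optimum; case: arg_minP => //= s' _ /(_ s isT) /le_trans; apply.
rewrite -[leRHS](far_sum_dist R n); apply: ler_sum => i _.
apply: le_trans (far_cost_le R n s i) _; rewrite far_dist_destination !ffunE eqxx.
by case: eqP => _ /=; lra.
Qed.

(** The punishment is triggered by any earlier choice of bus 1, whoever made it. *)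
Definition far_profile (R : realType) (n : nat) : profile (far_game R n) :=
  [ffun i : 'I_n.+1 => [ffun h : history (far_game R n) i =>
    if (i == ord_max) && [exists k, h k == ord_max :> 'I_2]
    then ord_max : 'I_2 else ord0]].

Lemma far_profile_spe (R : realType) (n : nat) : is_spe (far_profile R n).
Proof.
apply/forallP => i; apply/forallP => h; apply/forallP => b.
set s := continuation _ _ _; set s' := continuation _ _ b.
have [im|im] := eqVneq i ord_max.
  apply: le_trans (far_cost_le R n s i) _.
  apply: le_trans (dist_le_cost _ (far_game_metric R n) s' i).
  by rewrite far_dist_destination im eqxx /= mulr0 addr0.
(* Bus 0 is the prescribed choice, so both continuations coincide. *)
have [b0|b0] := eqVneq b (ord0 : 'I_2).
  by rewrite /s /s' {1}/far_profile !ffunE (negPf im) /= b0.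
have b1 : b = (ord_max : 'I_2).
  by apply: val_inj; case: b b0 {s'} => [[|[]]].
(* The value 2 separates the choices after any history: bus 0 costs at most 2, and bus 1 at least 2
   because [ord_max] follows. *)
apply: (@le_trans _ _ 2).
  apply: le_trans (far_cost_le R n s i) _; rewrite (negPf im) /=.
  by rewrite add0r ler_piMr // lern1 leq_b1.
apply: far_cost_ge2 => //.
have /and3P[_ /eqP s'i /forallP s'k] :
  is_continuation (far_profile R n) h b s' := xchooseP _.
have im' : (i < @ord_max n)%N.
  by rewrite ltn_neqAle im -ltnS ltn_ord.
have /implyP /(_ im') /eqP -> := s'k ord_max.
rewrite !ffunE eqxx /=.
case: existsP => [_|[]]; first by rewrite s'i.
(* The choice of bus 1 that [ord_max] observes is that of [i] herself. *)
exists (Ordinal im'); rewrite ffunE -b1 -s'i; apply/eqP; congr (s' _).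
exact: val_inj.
Qed.

Lemma far_profile_outcome (R : realType) (n : nat) :
  outcome_of (far_profile R n) = [ffun=> (ord0 : 'I_2)].
Proof.
apply: (is_outcome_unique (xchooseP (outcome_exists (far_profile R n)))).
apply/forallP => i; rewrite !ffunE; case: existsP => [[k]|_].
  by rewrite !ffunE.
by rewrite andbF.
Qed.

Lemma far_profile_utilitarian (R : realType) (n : nat) :
  2 * n.+1%:R - 1 <= utilitarian (outcome_of (far_profile R n)).
Proof.
rewrite far_profile_outcome.
(* Share the bound out as 1 for [ord_max] and 2 for each other player. *)
have -> : 2 * n.+1%:R - 1 = \sum_(i < n.+1) (2 - (i == ord_max)%:R) :> R.
  rewrite sumrB sumr_const card_ord mulr_natr; congr (_ - _).
  by rewrite (bigD1 ord_max) //= eqxx big1 ?addr0 // => i /negPf ->.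
apply: ler_sum => i _; have [im|im] := eqVneq i ord_max.
  apply: le_trans (dist_le_cost _ (far_game_metric R n) _ i).
  by rewrite far_dist_destination im eqxx lerBlDr -natrD.
by rewrite subr0; apply: far_cost_ge2 => //; rewrite !ffunE.
Qed.

Theorem theorem3p9 (R : realType) (n : nat) (hn : (1 <= n)%N) :
  class_spoa (@utilitarian R n) [set G : game R n | metric G]%classic
    = (2 * n%:R - 1)%:E.
Proof.
apply/eqP; rewrite eq_le; apply/andP; split.
  apply: ge_ereal_sup => _ [G [/= hG opt_gt0] <-].
  apply: bigmax_le => [|l _]; first exact: leNye.
  rewrite lee_fin ler_pdivrMr //.
  apply: le_trans (utilitarian_le G hG _) _.
  (* The lower bound applies to the optimum; the factor is nonnegative since [1 <= n]. *)
  apply: ler_wpM2l; last exact: sum_dist_le_utilitarian.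
  have : 1 <= n%:R :> R by rewrite ler1n.
  by lra.
case: n hn => // n _.
apply: (@le_trans _ _ (spoa (@utilitarian R n.+1 (far_game R n)))); last first.
  apply: ereal_sup_ubound; exists (far_game R n) => //; split; last by rewrite far_optimum.
  exact: far_game_metric.
apply: le_trans (le_bigmax_cond _ _ (far_profile_spe R n)).
by rewrite far_optimum divr1 lee_fin far_profile_utilitarian.
Qed.
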